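(* Let $b,c,a_1,a_2$ be positive integers, and consider integers $c(p,q)$ for $(p,q)\in\mathbb{Z}_{\ge0}^2$ with $c(0,0)=1$. The rule $$c(p,q)=\max\left(\sum_{k=1}^p(-1)^{k-1}c(p-k,q)\binom{a_2-cq+k-1}{k},\ \sum_{k=1}^q(-1)^{k-1}c(p,q-k)\binom{a_1-bp+k-1}{k}\right)$$ for every nonzero $(p,q)\in\mathbb{Z}_{\ge0}^2$ is equivalent to the rule $$c(p,q)=\begin{cases}\displaystyle\sum_{k=1}^p(-1)^{k-1}c(p-k,q)\binom{a_2-cq+k-1}{k}, & \text{if } ca_1q\le ba_2p;\\[2mm]\displaystyle\sum_{k=1}^q(-1)^{k-1}c(p,q-k)\binom{a_1-bp+k-1}{k}, & \text{if } ca_1q\ge ba_2p\end{cases}$$ for every nonzero $(p,q)\in\mathbb{Z}_{\ge0}^2$ (where, if $ca_1q=ba_2p$, both equalities are required).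
   Context: Conventions: the binomial coefficient $\binom{a}{k}$ is zero unless $0\le k\le a$, and an empty sum is $0$. The symbol $c$ denotes a fixed positive integer, while $c(p,q)$ denotes the family of integers. The first rule, together with $c(0,0)=1$, is the recurrence defining the coefficients in the expansion $x_1^{-a_1}x_2^{-a_2}\sum_{p,q\ge0}c(p,q)x_1^{bp}x_2^{cq}$ of the greedy element at $(a_1,a_2)$ of the rank 2 cluster algebra $\mathcal{A}(b,c)$. *)

(* Defs.v *)
From mathcomp Require Import all_boot all_order all_algebra.

Set Implicit Arguments.
Unset Strict Implicit.
Unset Printing Implicit Defensive.

Import Order.TTheory GRing.Theory Num.Theory.
Local Open Scope ring_scope.

(* Binomial coefficient with integer upper entry, zero unless 0 <= k <= a;
   in particular it is zero, not (-1)^k 'C(k - a - 1, k), when a < 0.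
   For a >= 0 the library's 'C(n, k) already vanishes when k > n. *)
Definition binz (a : int) (k : nat) : int :=
  if a is Posz n then ('C(n, k))%:Z else 0.

Section Rules.

Variables (b c a1 a2 : nat) (coef : nat -> nat -> int).

Definition sum1 (p q : nat) : int :=
  \sum_(1 <= k < p.+1)
    (-1) ^+ (k - 1)%N * coef (p - k)%N q
      * binz (a2%:Z - c%:Z * q%:Z + k%:Z - 1) k.

Definition sum2 (p q : nat) : int :=
  \sum_(1 <= k < q.+1)
    (-1) ^+ (k - 1)%N * coef p (q - k)%N
      * binz (a1%:Z - b%:Z * p%:Z + k%:Z - 1) k.

Definition max_rule : Prop :=
  forall p q : nat, (p, q) <> (0%N, 0%N) ->
    coef p q = Num.max (sum1 p q) (sum2 p q).

Definition slope_rule : Prop :=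
  forall p q : nat, (p, q) <> (0%N, 0%N) ->
    ((c * a1 * q <= b * a2 * p)%N -> coef p q = sum1 p q) /\
    ((c * a1 * q >= b * a2 * p)%N -> coef p q = sum2 p q).

End Rules.

(* Main.v *)
Require Import Defs.
From mathcomp Require Import all_boot all_order all_algebra.
From mathcomp Require Import zify ring.

(** Both rules determine the whole family from the value at (0, 0), so it is
    enough to exhibit one family obeying both.

    The family comes from counting. Let N = a1 + a2 and let the positions of
    Z/N carry the letters of the Christoffel word of slope a2/a1: position i is
    horizontal when (a2 * i) mod N < a1, and vertical otherwise. These are the
    steps of the maximal Dyck path in an a1 x a2 rectangle, read cyclically. Let
    f(p, q) be the number of compatible sets S made of p vertical and q
    horizontal positions, where compatible means that no horizontal i in S and
    vertical j in S shadow each other. Here every chosen vertical acts as b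
    closing brackets and every horizontal as an opening one, and j shadows i when
    the brackets of each final part of the arc from i to j, without i, still
    leave an unmatched closing one; horizontals shadow verticals in the same way,
    read forwards with c in place of b.

    A horizontal position that no chosen vertical shadows can be put into S or
    taken out of it without affecting compatibility ([compat_core]), and the
    cycle lemma says that exactly max(a1 - b p, 0) positions are of this kind
    ([card_unshadowed]). So f(p, q) is the convolution in q of binomials of
    upper entry a1 - b p with the number Q(p, j) of reduced sets, those all of
    whose horizontals are shadowed ([compat_countE]). Inverting the convolution
    gives f(p, q) - sum2(p, q) = Q(p, q) ([compat_count_sum2]). Reversing the
    word exchanges the roles of the two letters ([compat_count_mirror],
    [mirror_christoffel]) and gives f(p, q) - sum1(p, q) = P(p, q), where P
    counts the sets reduced in the other direction.

    Both defects are therefore nonnegative, and f satisfies both rules as soon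
    as Q vanishes for b a2 p <= c a1 q and P for c a1 q <= b a2 p, where (p, q)
    is not (0, 0). This is where the choice of the word enters: a reduced
    compatible set with p > 0 satisfies c a1 q < b a2 p ([reduced_slope]). Indeed,
    a region shadowed by verticals has at most b horizontals per chosen vertical;
    compatibility bounds c times its chosen horizontals by its verticals other
    than the last; and in a Christoffel word an arc that starts with a horizontal
    and ends with a vertical has, without that vertical, fewer verticals than the
    slope a2/a1 predicts. *)

Set Implicit Arguments.
Unset Strict Implicit.
Unset Printing Implicit Defensive.
Import Order.TTheory GRing.Theory Num.Theory.
Local Open Scope ring_scope.

(** * Compatible sets in a cyclic word *)

Section Words.
Variable n : nat.
Implicit Types (U S T : {set 'I_n.+1}) (b c i j k m L : nat).

(* Throughout, U is the set of horizontal positions of the word and ~: U that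
   of its vertical ones. *)

(** Reading cyclic positions along nat turns an arc that wraps around into an
    ordinary interval of integers. *)
Definition on U k : bool := inZp k \in U.

Lemma onE U (i : 'I_n.+1) : on U i = (i \in U).
Proof. by rewrite /on valZpK. Qed.

Lemma on_mod U k q : on U (q * n.+1 + k) = on U k.
Proof. by rewrite /on; congr (_ \in U); apply: val_inj; rewrite /= modnMDl. Qed.

Lemma onD U S k : on (S :\: U) k = ~~ on U k && on S k.
Proof. by rewrite /on inE. Qed.
Lemma onI U S k : on (S :&: U) k = on S k && on U k.
Proof. by rewrite /on inE. Qed.
Lemma onC U k : on (~: U) k = ~~ on U k.
Proof. by rewrite /on inE. Qed.

Definition occ U k : nat := (\sum_(i < k) on U i)%N.

Lemma occS U k : occ U k.+1 = (occ U k + on U k)%N.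
Proof. by rewrite /occ big_ord_recr. Qed.

Lemma occ_period U k : occ U (n.+1 + k) = (#|U| + occ U k)%N.
Proof.
rewrite /occ big_split_ord /=; congr (_ + _)%N.
  rewrite -sum1_card [RHS]big_mkcond /=; apply: eq_bigr => i _.
  by rewrite onE; case: (i \in U).
by apply: eq_bigr => i _; rewrite -[n.+1]mul1n on_mod.
Qed.

(** The bracket height, or backward height: each letter of U costs 1 and each
    chosen letter outside U earns b. With ~: U and c for U and b it is the forward
    height, for which chosen horizontals earn c. *)
Definition height U S b k : int :=
  \sum_(i < k) (if on U i then -1 else (b * on S i)%:Z).

Lemma height0 U S b : height U S b 0 = 0.
Proof. by rewrite /height big_ord0. Qed.

Lemma heightS U S b k :
  height U S b k.+1 = height U S b k + (if on U k then -1 else (b * on S k)%:Z).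
Proof. by rewrite /height big_ord_recr. Qed.

Lemma heightE U S b k :
  height U S b k = (b * occ (S :\: U) k)%:Z - (occ U k)%:Z.
Proof.
elim: k => [|k IH]; first by rewrite height0 /occ !big_ord0; lia.
rewrite heightS IH !occS onD; case: (on U k); case: (on S k) => /=; lia.
Qed.

Definition excess U S b : int := (b * #|S :\: U|)%:Z - #|U|%:Z.

Lemma height_period U S b k :
  height U S b (n.+1 + k) = excess U S b + height U S b k.
Proof. by rewrite !heightE !occ_period /excess; lia. Qed.

Lemma height_mod U S b q k :
  height U S b (q * n.+1 + k) = excess U S b *+ q + height U S b k.
Proof.
elim: q => [|q IH]; first by rewrite mulr0n add0r.
by rewrite mulSn -addnA height_period IH mulrS addrA.
Qed.

(** The letter j shadows i when the brackets earned by the verticals of every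
    final part of the arc from i to j exceed the horizontals of that part; in
    terms of heights, j.+1 is strictly above every cut strictly after i. The
    second inequality is the same condition for i to shadow j, read from the
    left. *)
Definition mutual U S b c i j : bool :=
  [&& on U i && on S i, ~~ on U j && on S j &
      [forall m : 'I_j.+1, (i < m)%N ==>
         (height U S b m < height U S b j.+1) &&
         (height (~: U) S c i < height (~: U) S c m)]].

Lemma mutualP U S b c i j :
  reflect [/\ on U i && on S i, ~~ on U j && on S j &
             forall m, (i < m <= j)%N ->
               height U S b m < height U S b j.+1 /\
               height (~: U) S c i < height (~: U) S c m]
          (mutual U S b c i j).
Proof.
apply: (iffP and3P) => -[hi hj hm]; split=> //.
  move=> m /andP[im mj]; have mj' : (m < j.+1)%N by [].
  by have /forallP/(_ (Ordinal mj'))/implyP/(_ im)/andP := hm.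
apply/forallP => m; apply/implyP => im; apply/andP; apply: hm.
by rewrite im -ltnS ltn_ord.
Qed.

Lemma mutual_mod U S b c q i j :
  mutual U S b c (q * n.+1 + i) (q * n.+1 + j) = mutual U S b c i j.
Proof.
apply/mutualP/mutualP; rewrite !on_mod => -[hi hj hm]; split=> // m.
  move=> imj; have := hm (q * n.+1 + m)%N.
  rewrite -[(_ + j).+1]addnS !height_mod !ltrD2l ltn_add2l leq_add2l.
  by apply.
move=> imj.
have -> : m = (q * n.+1 + (m - q * n.+1))%N by lia.
by rewrite -[(_ + j).+1]addnS !height_mod !ltrD2l; apply: hm; lia.
Qed.

Definition compat U S b c : bool :=
  [forall i : 'I_n.+1, forall j : 'I_(i + n.+1), (i < j)%N ==>
     ~~ mutual U S b c i j].

Lemma compatP U S b c :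
  reflect (forall i j, (i < j < i + n.+1)%N -> ~~ mutual U S b c i j)
          (compat U S b c).
Proof.
apply: (iffP forallP) => h i; last first.
  by apply/forallP => j; apply/implyP => ij; apply: h; rewrite ij ltn_ord.
move=> j /andP[ij jin].
rewrite [X in mutual _ _ _ _ X](divn_eq i n.+1).
set q := (i %/ n.+1)%N; have hi := divn_eq i n.+1; rewrite -/q in hi.
have -> : j = (q * n.+1 + (j - q * n.+1))%N by lia.
rewrite mutual_mod.
have jlt : (j - q * n.+1 < inZp (p' := n) i + n.+1)%N by move=> /=; lia.
have /forallP/(_ (Ordinal jlt))/implyP := h (inZp i); apply => /=; lia.
Qed.

(** If some cut within a turn is higher than the one just after k, then the first
    such cut is higher than all those in between, so the letter that ends there
    shadows k. Asking for one higher cut is therefore enough. *)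
Definition shadow U S b : {set 'I_n.+1} :=
  [set i in U | [exists L : 'I_n.+1,
     height U S b i.+1 < height U S b (i.+1 + L)]].

Lemma shadowP U S b k : on U k ->
  reflect (exists2 L, (L < n.+1)%N &
             height U S b k.+1 < height U S b (k.+1 + L))
          (on (shadow U S b) k).
Proof.
move=> Uk; have hk := divn_eq k n.+1.
have e L : height U S b (k.+1 + L) =
           excess U S b *+ (k %/ n.+1) +
           height U S b ((inZp (p' := n) k).+1 + L).
  by rewrite -height_mod; congr height => /=; lia.
rewrite /on inE -/(on U k) Uk /=.
apply: (iffP existsP) => [[L hL]|[L lL hL]].
  by exists L => //; rewrite -[X in height _ _ _ X]addn0 !e ltrD2l addn0.
exists (Ordinal lL) => /=; move: hL.
by rewrite -[X in height _ _ _ X < _]addn0 !e ltrD2l addn0.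
Qed.

Lemma shadow_sub U S b : shadow U S b \subset U.
Proof. by apply/subsetP => i; rewrite inE => /andP[]. Qed.

(** The cycle lemma. A position of U is not shadowed when the height never rises
    again above its value just after it. The maximum M k of the heights over the
    period starting at k decreases by 1 at each such position and is constant
    elsewhere, so their number is the drop of the height over a full turn. *)
Lemma card_unshadowed U S b :
  #|U :\: shadow U S b| = (#|U| - b * #|S :\: U|)%N.
Proof.
pose H := height U S b.
have [Tpos|Tneg] := leqP (b * #|S :\: U|) #|U|; last first.
  (* The height grows over a full turn, which shadows every position. *)
  have -> : (#|U| - b * #|S :\: U| = 0)%N by lia.
  apply/eqP; rewrite cards_eq0 -subset0; apply/subsetP => i.
  rewrite !inE; case Ui: (i \in U); rewrite ?andbF ?andbT //=.
  case/negP; apply/existsP; exists ord_max => /=.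
  rewrite (_ : i.+1 + n = n.+1 + i)%N; last by lia.
  rewrite height_period /excess heightS onE Ui; lia.
pose M k := \big[Order.max/H k]_(L < n.+1) H (k + L)%N.
have leM k L : (L < n.+1)%N -> H (k + L)%N <= M k.
  by move=> lL; rewrite /M (bigmaxD1 (Ordinal lL)) //= le_max lexx.
have exM k : exists2 L, (L < n.+1)%N & M k = H (k + L)%N.
  rewrite /M; elim/big_ind: _ => [|a a' [L ? ->] [L' ? ->]|L _].
  - by exists 0%N; rewrite ?addn0.
  - by rewrite maxEle; case: ifP => _; [exists L'|exists L].
  - by exists L.
have Tle k : H (n.+1 + k)%N <= H k by rewrite /H height_period /excess; lia.
have step k : M k - M k.+1 = (on (U :\: shadow U S b) k)%:Z.
  rewrite onD; case Uk: (on U k); rewrite ?andbT ?andbF /=; last first.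
    have Hk : H k <= H k.+1 by rewrite /H heightS Uk; lia.
    apply/eqP; rewrite subr_eq0 eq_le; apply/andP; split.
      have [L lL ->] := exM k; case: L lL => [|L] lL.
        rewrite addn0; apply: le_trans Hk _.
        by rewrite -[X in H X]addn0; apply: leM.
      by rewrite addnS -addSn; apply: leM; lia.
    have [L lL ->] := exM k.+1; have [lt|ge] := ltnP L n.
      by rewrite addSn -addnS; apply: leM.
    rewrite (_ : k.+1 + L = n.+1 + k)%N; last by lia.
    by apply: le_trans (Tle _) _; rewrite -[X in H X]addn0; apply: leM.
  have Hk : H k.+1 = H k - 1 by rewrite /H heightS Uk.
  have M1 : H k.+1 <= M k.+1 by rewrite -[X in H X]addn0; apply: leM.
  have M0 : H k <= M k by rewrite -[X in H X]addn0; apply: leM.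
  have M01 : M k.+1 <= M k.
    have [L lL ->] := exM k.+1; have [lt|ge] := ltnP L n.
      by rewrite addSn -addnS; apply: leM.
    rewrite (_ : k.+1 + L = n.+1 + k)%N; last by lia.
    by apply: le_trans (Tle _) _.
  have M02 : M k <= Num.max (H k) (M k.+1).
    have [L lL ->] := exM k; case: L lL => [|L] lL.
      by rewrite addn0 le_max lexx.
    by rewrite addnS -addSn le_max (leM k.+1 L) ?orbT //; lia.
  case: (shadowP S b Uk) => [[L lL hL]|hL] /=.
    have := leM k.+1 L lL; move: M02 hL; rewrite -!/(H _); lia.
  have : M k.+1 <= H k.+1.
    have [L lL ->] := exM k.+1; rewrite leNgt; apply/negP => hh.
    by apply: hL; exists L.
  lia.
have : \sum_(0 <= k < n.+1) (M k - M k.+1) = M 0%N - M n.+1.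
  rewrite -opprB -telescope_sumr // -sumrN.
  by apply: eq_bigr => k _; rewrite opprB.
rewrite (eq_bigr (fun k => (on (U :\: shadow U S b) k)%:Z)) => [|k _];
  last first.
  exact: step.
rewrite big_mkord -(big_morph Posz PoszD (erefl _)).
rewrite -/(occ _ _) -[X in occ _ X]addn0 occ_period /occ big_ord0 addn0.
have -> : M n.+1 = excess U S b + M 0%N.
  apply/eqP; rewrite eq_le; apply/andP; split.
    have [L lL ->] := exM n.+1; rewrite /H height_period lerD2l.
    exact: (leM 0%N).
  have [L lL ->] := exM 0%N; rewrite -height_period; exact: (leM n.+1).
rewrite /excess; lia.
Qed.

Lemma eq_height U S T b : S :\: U = T :\: U -> height U S b =1 height U T b.
Proof. by move=> e k; rewrite !heightE e. Qed.

Lemma eq_shadow U S T b : S :\: U = T :\: U -> shadow U S b = shadow U T b.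
Proof.
move=> e; apply/setP => i; rewrite !inE; congr (_ && _).
by apply: eq_existsb => L; rewrite !(eq_height _ e).
Qed.

(** The map S |-> core U S b forgets the free part of S; its image consists of
    the reduced sets, and its fibres are counted by a binomial coefficient. *)
Definition core U S b := S :\: (U :\: shadow U S b).

Lemma coreD U S b : core U S b :\: U = S :\: U.
Proof. by apply/setP => i; rewrite !inE; case: (i \in U); rewrite //= andbF. Qed.

Lemma coreI U S b : core U S b :&: U = S :&: shadow U S b.
Proof.
apply/setP => i; rewrite /core in_setI in_setD in_setD in_setI.
have := subsetP (shadow_sub U S b) i.
case: (i \in shadow U S b) => [/(_ isT) ->|_] /=; first by rewrite !andbT.
by rewrite andbF; case: (i \in U); rewrite ?andbF.
Qed.

(** If i and j are mutual, then all horizontals between them are shadowed by j;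
    hence core removes none of them, and the forward height of the arc from i to
    j is the same for S and for its core. Conversely, removing horizontals only
    lowers the forward height. *)
Lemma compat_core U S b c : compat U (core U S b) b c = compat U S b c.
Proof.
have e2 := eq_height b (coreD U S b).
have onK k : on U k -> on (core U S b) k = on S k && on (shadow U S b) k.
  by move=> Uk; rewrite /core !onD Uk andbT negbK andbC.
have onV k : ~~ on U k -> on (core U S b) k = on S k.
  by move=> Uk; rewrite /core !onD (negbTE Uk) andbF.
apply/compatP/compatP => h i j ij; apply/negP => /mutualP[hi hj hm];
  have /negP[] := h i j ij; apply/mutualP.
  have sh k : (i <= k < j)%N -> on U k -> on (shadow U S b) k.
    move=> ikj Uk; apply/(shadowP S b Uk); exists (j - k)%N; first by lia.
    rewrite (_ : (k.+1 + _ = j.+1)%N); last by lia.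
    by apply: (hm _ _).1; lia.
  have e1 m : (i <= m <= j)%N ->
     height (~: U) (core U S b) c m - height (~: U) (core U S b) c i =
     height (~: U) S c m - height (~: U) S c i.
    elim: m => [|m IH] imj; first by rewrite (_ : i = 0%N) ?subrr //; lia.
    have [im|im] := eqVneq i m.+1; first by rewrite im !subrr.
    have {}IH := IH ltac:(lia).
    rewrite !heightS onC; case Um: (on U m) => /=; last by move: IH; lia.
    by rewrite (onK _ Um) (sh _ _ Um) ?andbT; [move: IH; lia|lia].
  split=> [||m imj].
  - case/andP: hi => Ui Si; rewrite Ui (onK _ Ui) Si sh //; lia.
  - by case/andP: hj => Uj Sj; rewrite Uj (onV _ Uj).
  - rewrite !e2; have [h1 h2] := hm m imj; split=> //.
    have := e1 m ltac:(lia); lia.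
have e1 m : (i <= m)%N ->
   height (~: U) (core U S b) c m - height (~: U) (core U S b) c i <=
   height (~: U) S c m - height (~: U) S c i.
  elim: m => [|m IH] im; first by rewrite (_ : i = 0%N) ?subrr //; lia.
  have [im'|im'] := eqVneq i m.+1; first by rewrite im' !subrr.
  have {}IH := IH ltac:(lia).
  rewrite !heightS onC; case Um: (on U m) => /=; last by move: IH; lia.
  by rewrite (onK _ Um); case: (on S m); case: (on (shadow U S b) m);
    move: IH => /=; lia.
split=> [||m imj].
- by case/andP: hi => Ui; rewrite Ui (onK _ Ui) => /andP[->].
- by case/andP: hj => Uj; rewrite Uj (onV _ Uj).
- have [h1 h2] := hm m imj; rewrite -!e2; split=> //.
  have := e1 m ltac:(lia); lia.
Qed.

Definition reduced U S b := S :&: U \subset shadow U S b.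

Lemma core_reduced U S b : reduced U (core U S b) b.
Proof. by rewrite /reduced coreI (eq_shadow b (coreD U S b)) subsetIr. Qed.

Lemma core_fiber U S T b : reduced U T b ->
  (core U S b == T) =
  (S :\: U == T :\: U) && (S :&: shadow U T b == T :&: U).
Proof.
move=> rT; apply/eqP/andP => [<-|[/eqP eD /eqP eI]].
  by rewrite coreD coreI (eq_shadow b (coreD U S b)).
have eS := eq_shadow b eD.
rewrite -(setID (core U S b) U) coreD coreI eS eD eI; exact: setID.
Qed.

Lemma card_core_fiber U T b q : reduced U T b ->
  #|[set S | (#|S :&: U| == q) && (core U S b == T)]| =
  if (#|T :&: U| <= q)%N then
    'C(#|U| - b * #|T :\: U|, q - #|T :&: U|)%N else 0%N.
Proof.
move=> rT; set F := U :\: shadow U T b.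
have sU := shadow_sub U T b.
have split S : core U S b == T -> #|S :&: U| = (#|T :&: U| + #|S :&: F|)%N.
  rewrite core_fiber // => /andP[_ /eqP <-].
  rewrite -(cardsID (shadow U T b)); congr (_ + _)%N.
    by rewrite -setIA (setIidPr sU).
  by rewrite -setIDA.
have [le|gt] := leqP; last first.
  apply: eq_card0 => S; rewrite inE; apply/negP => /andP[/eqP e1 /split e2].
  by lia.
rewrite -card_unshadowed -/F -cards_draws.
have TF : T :&: F = set0.
  apply/eqP; rewrite setIDA setD_eq0; exact: rT.
have inj : {in [set E : {set _} | E \subset F & #|E| == (q - #|T :&: U|)%N] &,
            injective (fun E => T :|: E)}.
  move=> E E'; rewrite !inE => /andP[sE _] /andP[sE' _] e.
  have : (T :|: E) :&: F = (T :|: E') :&: F by rewrite e.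
  by rewrite !setIUl TF !set0U (setIidPl sE) (setIidPl sE').
rewrite -(card_in_imset inj); apply: eq_card => S; rewrite inE.
apply/andP/imsetP => [[/eqP cS core]|[E]].
  exists (S :&: F).
    by rewrite inE subsetIr /= -cS (split _ core) addKn.
  move: core; rewrite core_fiber // => /andP[/eqP eD /eqP eI].
  rewrite -{1}(setID S U) -{1}(setID T U) eD -eI -!setUA.
  rewrite [T :\: U :|: _]setUC !setUA; congr (_ :|: _).
  rewrite -setIUr; congr (_ :&: _); rewrite /F.
  by rewrite -{1}(setID U (shadow U T b)) (setIidPr sU).
rewrite inE => /andP[sE /eqP cE] ->.
have sEU : E \subset U by apply: subset_trans sE (subsetDl _ _).
have cr : core U (T :|: E) b == T.
  rewrite core_fiber // setDUl (_ : E :\: U = set0) ?setU0 ?eqxx; last first.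
    by apply/eqP; rewrite setD_eq0.
  rewrite setIUl (_ : E :&: shadow U T b = set0) ?setU0; last first.
    apply/eqP; rewrite setI_eq0; rewrite disjoints_subset.
    by apply: subset_trans sE _; rewrite /F setDE subsetIr.
  apply/eqP/setP => i; apply/setIP/setIP => -[iT h]; split => //.
    exact: (subsetP sU).
  by apply: (subsetP rT); rewrite inE iT h.
split=> //.
by rewrite (split _ cr) setIUl TF set0U (setIidPl sE) cE subnKC.
Qed.

Definition compat_count U b c p q : nat :=
  #|[set S | [&& #|S :\: U| == p, compat U S b c & #|S :&: U| == q]]|.
Definition reduced_count U b c p j : nat :=
  #|[set T | [&& #|T :\: U| == p, compat U T b c, reduced U T b
      & #|T :&: U| == j]]|.

(** Sorting the compatible sets by their core: the core fixes p, and a free part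
    of size q - j completes a core with j horizontals. *)
Lemma compat_countE U b c p q :
  compat_count U b c p q =
  (\sum_(j < q.+1) reduced_count U b c p j * 'C(#|U| - b * p, q - j))%N.
Proof.
pose P T := [&& #|T :\: U| == p, compat U T b c & reduced U T b].
rewrite /compat_count -sum1_card.
rewrite (partition_big (fun S => core U S b) P) /=; last first.
  by move=> S; rewrite inE /P coreD compat_core core_reduced => /and3P[-> ->].
have e1 T : P T ->
    (\sum_(S in [set S | [&& #|S :\: U| == p, compat U S b c & #|S :&: U| == q]]
       | core U S b == T) 1 =
     \sum_(j < q.+1 | #|T :&: U| == j) 'C(#|U| - b * p, q - j))%N.
  case/and3P => /eqP cT coT rT.
  rewrite (eq_bigl (mem [set S | (#|S :&: U| == q) && (core U S b == T)])).
    rewrite sum1_card card_core_fiber // cT.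
    have [le|gt] := leqP; last first.
      by rewrite big_pred0 // => j; apply/negP => /eqP e;
        move: (ltn_ord j) gt; lia.
    by rewrite (big_pred1 (Ordinal (n := q.+1) le)) // => j; rewrite eq_sym.
  move=> S; rewrite !inE; case e: (core U S b == T); rewrite ?andbF //= !andbT.
  by rewrite -compat_core -(coreD U S b) (eqP e) cT eqxx coT.
rewrite (eq_bigr _ e1) (exchange_big_dep xpredT) //=; apply: eq_bigr => j _.
rewrite sum_nat_const; congr (_ * _)%N; apply: eq_card => T.
by rewrite !inE /P unfold_in -!andbA.
Qed.

End Words.

(** * Reduced sets in a Christoffel word *)

Lemma first_argmax (H : nat -> int) x y : (x < y)%N ->
  exists F, [/\ (x < F <= y)%N, forall k, (x < k <= y)%N -> H k <= H F &
                forall m, (x < m < F)%N -> H m < H F].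
Proof.
elim: y => // y IH; rewrite ltnS leq_eqVlt => /predU1P[->|/IH].
  exists y.+1; split=> [|k kb|m]; [lia| |lia].
  by rewrite (_ : k = y.+1) //; lia.
case=> F [xF maxF firstF]; have [le|gt] := leP (H y.+1) (H F).
  exists F; split=> // [|k kb]; first lia.
  by have [->|] := eqVneq k y.+1; last by move=> ?; apply: maxF; lia.
exists y.+1; split=> [|k kb|m mb]; first lia.
  by have [->|?] := eqVneq k y.+1; last by have := maxF k ltac:(lia); lia.
by have := maxF m ltac:(lia); lia.
Qed.

Section Christoffel.
Variables (n b c a1 a2 : nat) (S : {set 'I_n.+1}).
Hypothesis a12 : (a1 + a2 = n.+1)%N.

(** The horizontal steps of the maximal Dyck path below the diagonal of an
    a1 x a2 rectangle. If step i starts at (x, y), the residue (a2 * i) mod n.+1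
    is a2 x - a1 y, the scaled depth of that point below the diagonal; the path
    goes up as soon as it can do so without crossing the diagonal. *)
Definition christoffel : {set 'I_n.+1} :=
  [set i : 'I_n.+1 | ((a2 * i) %% n.+1 < a1)%N].
Local Notation U := christoffel.

Lemma on_christoffel k : on U k = ((a2 * k) %% n.+1 < a1)%N.
Proof. by rewrite /on inE /= modnMmr. Qed.

(** A horizontal step raises the residue by a2 and a vertical one lowers it by
    a1, without wrapping around. *)
Lemma slope_step k :
  ((a2 * k.+1) %% n.+1)%:Z =
  ((a2 * k) %% n.+1)%:Z + (if on U k then a2%:Z else - a1%:Z).
Proof.
rewrite on_christoffel mulnS addnC -modnDml; set g := ((a2 * k) %% n.+1)%N.
have gn : (g < n.+1)%N by rewrite ltn_mod.
case: ifP => ga; first by rewrite modn_small; lia.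
rewrite (_ : (g + a2)%N = (g - a1) + n.+1)%N; last lia.
by rewrite modnDr modn_small; lia.
Qed.

Lemma slopeE k :
  ((a2 * k) %% n.+1)%:Z = a2%:Z * (occ U k)%:Z - a1%:Z * (k%:Z - (occ U k)%:Z).
Proof.
elim: k => [|k IH]; first by rewrite muln0 mod0n /occ big_ord0; lia.
by rewrite slope_step IH occS; case: (on U k); lia.
Qed.

Lemma card_christoffel : #|U| = a1.
Proof.
have := slopeE n.+1.
rewrite modnMl -[X in occ _ X]addn0 occ_period /occ big_ord0.
nia.
Qed.

Local Notation H2 := (height U S b).
Local Notation H1 := (height (~: U) S c).

(* The quantity whose growth over a full turn is to be shown positive. By DE it
   combines the two heights with the bounded residue of the word. *)
Let D k : int :=
  (b * a2 * occ (S :\: U) k)%:Z - (c * a1 * occ (S :&: U) k)%:Z.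

Lemma occC k : (occ (~: U) k + occ U k = k)%N.
Proof.
elim: k => [|k IH]; first by rewrite /occ !big_ord0.
by rewrite !occS onC; case: (on U k) => /=; lia.
Qed.

Let DE k : D k = a2%:Z * H2 k - a1%:Z * H1 k + ((a2 * k) %% n.+1)%:Z.
Proof.
rewrite /D slopeE !heightE [S :\: ~: U]setDE setCK.
have := occC k; set v := occ (~: U) k => e.
by rewrite (_ : k%:Z = v%:Z + (occ U k)%:Z); [ring|lia].
Qed.

Hypothesis (b0 : (0 < b)%N) (a20 : (0 < a2)%N).
Hypothesis (coS : compat U S b c) (rS : reduced U S b).

Let in_shadow k : on S k -> on U k ->
  exists2 L, (L < n.+1)%N & H2 k.+1 < H2 (k.+1 + L)%N.
Proof.
move=> Sk Uk; apply/(shadowP S b Uk).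
by apply: (subsetP rS); rewrite -[_ \in _]/(on _ _) onI Sk.
Qed.

(* All horizontals from x to j are shadowed by j, so no chosen one among them may
   shadow j: after each of them the forward height comes back down at some cut up
   to j. The other letters do not raise it. *)
Let descent x j : (x <= j <= x + n)%N ->
  (forall m, (x < m <= j)%N -> H2 m < H2 j.+1) -> ~~ on U j -> on S j ->
  H1 j <= H1 x.
Proof.
move: {2}(j - x)%N (leqnn (j - x)) => d.
elim: d x => [|d IH] x dj xj climb Vj Sj.
  by rewrite (_ : x = j) //; lia.
have [->//|nxj] := eqVneq x j.
have next x' : (x < x' <= j)%N -> H1 x' <= H1 x -> H1 j <= H1 x.
  move=> xx' h; apply: le_trans h; apply: IH => //; try lia.
  by move=> m mb; apply: climb; lia.
have [USx|nUSx] := boolP (on U x && on S x); last first.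
  apply: (next x.+1); first lia.
  rewrite heightS onC; move: nUSx.
  by case: (on U x) => //=; case: (on S x) => //; lia.
have /negP nm := elimT (compatP _ _ _ _) coS x j ltac:(lia).
have [/existsP[A /andP[xA hA]]|/existsPn none] :=
  boolP [exists A : 'I_j.+1, (x < A)%N && (H1 A <= H1 x)].
  by apply: (next A) => //; rewrite xA -ltnS ltn_ord.
case: nm; apply/mutualP; split; rewrite ?Vj // => m mb.
split; first exact: climb.
by have := none (inord m); rewrite inordK; [rewrite (andP mb).1 ltNge|lia].
Qed.

(* Here j is the last letter of the shadow region entered at x: the first place
   where the backward height is maximal. No cut between x and that place is as
   high, so j shadows every horizontal from x on. *)
Let close_shadow x y : on S x -> on U x -> (y <= x + n.+1)%N ->
  (exists2 k, (x < k <= y)%N & H2 x.+1 < H2 k) ->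
  exists j, [/\ (x < j < y)%N, ~~ on U j, H2 x.+1 < H2 j.+1,
    forall k, (x < k <= y)%N -> H2 k <= H2 j.+1 & H1 j <= H1 x].
Proof.
move=> Sx Ux yx [k0 k0b hk0].
have [F [xF maxF firstF]] := first_argmax H2 (x := x) (y := y) ltac:(lia).
have up : H2 x.+1 < H2 F by apply: lt_le_trans hk0 (maxF _ _).
case: F xF maxF firstF up => [|j]; first by lia.
move=> xj maxF firstF up.
have xlj : (x < j)%N.
  rewrite ltn_neqAle -ltnS (andP xj).1 andbT.
  apply: contraTneq up => ->.
  by rewrite ltxx.
have := firstF j ltac:(lia); rewrite heightS.
case Vj: (on U j); first lia.
case Sj: (on S j); last by rewrite muln0; lia.
move=> _; exists j; split; rewrite ?Vj //; first lia.
by apply: descent; rewrite ?Vj ?Sj //; lia.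
Qed.

(* Walk from x to a peak y of the backward height. A letter that is not a chosen
   horizontal is passed in one step, which does not lower D. At a chosen
   horizontal the walk jumps to the end of the shadow region: the backward
   height does not drop, and the forward height, already back to its value
   at x before the last letter, drops by 1 more there. That gains a1 in D, while
   the residue, which is below a1 at the horizontal x and nonnegative at the end,
   loses less than a1. *)
Let walk x y : (x <= y <= x + n.+1)%N ->
  (forall k, (y <= k <= y + n.+1)%N -> H2 k <= H2 y) ->
  D x <= D y /\ ((occ (S :\: U) x < occ (S :\: U) y)%N -> D x < D y).
Proof.
move: {2}(y - x)%N (leqnn (y - x)) => d.
elim: d x => [|d IH] x dy xy top.
  by rewrite (_ : x = y) ?ltnn //; lia.
have [->|nxy] := eqVneq x y; first by rewrite ltnn.
have [/andP[Ux Sx]|nUSx] := boolP (on U x && on S x); last first.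
  have [le lt] := IH x.+1 ltac:(lia) ltac:(lia) top.
  have -> : D x = D x.+1 - (b * a2 * (~~ on U x && on S x))%N%:Z.
    rewrite /D !occS onD onI; move: nUSx.
    by case: (on U x); case: (on S x) => //= _; lia.
  rewrite occS onD in lt; move: nUSx le lt.
  case: (on U x); case: (on S x) => //= _ le lt; rewrite ?muln1 ?muln0.
  - by split=> [|h]; [lia|have := lt ltac:(lia); lia].
  - have ba : (0 < b * a2)%N by rewrite muln_gt0 b0 a20.
    by split=> [|_]; lia.
  - by split=> [|h]; [lia|have := lt ltac:(lia); lia].
have [L ln hL] := in_shadow Sx Ux.
have [||j [xj Vj up maxj down]] := close_shadow (y := y) Sx Ux; first lia.
  have [le|gt] := leqP (x.+1 + L) y; first by exists (x.+1 + L)%N => //; lia.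
  by exists y; [lia|apply: lt_le_trans hL (top _ _); lia].
have [le lt] := IH j.+1 ltac:(lia) ltac:(lia) top.
suff : D x < D j.+1 by move=> ?; split=> [|_]; lia.
have H1j : H1 j.+1 = H1 j - 1 by rewrite heightS onC (negbTE Vj).
have H2x : H2 x.+1 = H2 x - 1 by rewrite heightS Ux.
have := on_christoffel x; rewrite Ux !DE H1j => /esym gx.
have : 0 <= a2%:Z * (H2 j.+1 - H2 x) by apply: mulr_ge0; lia.
have : 0 <= a1%:Z * (H1 x - H1 j) by apply: mulr_ge0; lia.
lia.
Qed.

(** When the backward height does not grow over a full turn, one turn starting
    at a peak is a walk to a peak. Otherwise b times the number of chosen
    verticals exceeds a1, and it is enough that the forward height does not grow
    over a turn; this holds because from any cut it comes back to a value at most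
    as large within one turn. *)
Lemma reduced_slope : (0 < #|S :\: U|)%N ->
  (c * a1 * #|S :&: U| < b * a2 * #|S :\: U|)%N.
Proof.
move=> S2; have [T2|T2] := leqP (b * #|S :\: U|) a1.
  have [y [y_le top _]] := first_argmax H2 (x := 0) (y := n.+1) isT.
  have per k : H2 (n.+1 + k)%N <= H2 k.
    by rewrite height_period /excess card_christoffel; lia.
  have top0 k : (y <= k <= y + n.+1)%N -> H2 k <= H2 y.
    move=> kb; have [le|gt] := leqP k n.+1; first by apply: top; lia.
    rewrite (_ : k = n.+1 + (k - n.+1))%N; last lia.
    by apply: le_trans (per _) (top _ _); lia.
  have [] := @walk y (n.+1 + y) ltac:(lia) => [k kb|_].
    rewrite (_ : k = n.+1 + (k - n.+1))%N; last lia.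
    by rewrite !height_period lerD2l; apply: top0; lia.
  rewrite /D !occ_period => /(_ ltac:(lia)); lia.
suff c1 : (c * #|S :&: U| <= a2)%N by nia.
rewrite leqNgt; apply/negP => T1.
have cU : #|~: U| = a2.
  by have := cardsC U; rewrite card_christoffel card_ord; lia.
have next x : exists2 A, (x < A <= x + n.+1)%N & H1 A <= H1 x.
  have [/andP[Ux Sx]|nUSx] := boolP (on U x && on S x); last first.
    exists x.+1; first lia.
    rewrite heightS onC; move: nUSx.
    by case: (on U x) => //=; case: (on S x) => //; lia.
  have [L ln hL] := in_shadow Sx Ux.
  have [||j [xj _ _ _ down]] := close_shadow (y := x + n.+1) Sx Ux; first lia.
    by exists (x.+1 + L)%N => //; lia.
  by exists j => //; lia.
(* Iterated returns lead into the next turn, where the values exceed those of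
   the present one: this contradicts the choice of a lowest cut y. *)
have later x : (x <= n.+1)%N ->
    exists2 A, (n.+1 < A <= n.+1 + n.+1)%N & H1 A <= H1 x.
  move: {2}(n.+1 - x)%N (leqnn (n.+1 - x)) => d.
  elim: d x => [|d IH] x dx xn; have [A xA hA] := next x.
    by exists A => //; lia.
  have [An|An] := leqP A n.+1; last by exists A => //; lia.
  have [A' A'b hA'] := IH A ltac:(lia) An.
  by exists A' => //; apply: le_trans hA' hA.
have [y [yb bot _]] := first_argmax (fun k => - H1 k) (x := 0) (y := n.+1) isT.
have [A Ab hA] := later y ltac:(lia).
have := bot (A - n.+1)%N ltac:(lia).
move: hA; rewrite {1}(_ : A = n.+1 + (A - n.+1))%N; last lia.
rewrite height_period /excess cU setDE setCK; lia.
Qed.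
End Christoffel.

(** * Reversing the word *)

Section Mirror.
Variable n : nat.
Implicit Types (U S : {set 'I_n.+1}) (b c i j k m p q K : nat).

Definition mirror S : {set 'I_n.+1} := @rev_ord n.+1 @^-1: S.

Lemma mirrorK : involutive mirror.
Proof. by move=> S; apply/setP => i; rewrite !inE rev_ordK. Qed.

Lemma card_mirror S : #|mirror S| = #|S|.
Proof. exact: on_card_preimset (onW_bij _ (inv_bij (@rev_ordK _))). Qed.

Lemma mirrorC S : mirror (~: S) = ~: mirror S.
Proof. exact: preimsetC. Qed.

(** Any multiple of the period not below k can serve as the centre of the
    reversal, which keeps the subtraction from truncating. *)
Lemma on_mirror S k K : (k < K * n.+1)%N ->
  on (mirror S) k = on S (K * n.+1 - k.+1).
Proof.
move=> kK; rewrite /on inE; congr (_ \in S); apply: val_inj => /=.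
have hk := divn_eq k n.+1.
set q := (k %/ n.+1)%N in hk *; set r := (k %% n.+1)%N in hk *.
have rn : (r < n.+1)%N by rewrite ltn_mod.
have qK : (q < K)%N by rewrite ltn_divLR.
rewrite (_ : (K * n.+1 - k.+1 = (K - q.+1) * n.+1 + (n - r))%N).
  by rewrite modnMDl modn_small //; lia.
by rewrite mulnBl mulSn; have := leq_mul qK (leqnn n.+1); lia.
Qed.

Lemma height_mirror U S b k K : (k <= K * n.+1)%N ->
  height (mirror U) (mirror S) b k =
  height U S b (K * n.+1) - height U S b (K * n.+1 - k).
Proof.
elim: k => [|k IH] kK; first by rewrite height0 subn0 subrr.
rewrite heightS IH; last lia.
rewrite !(@on_mirror _ k K) //.
rewrite [in RHS](_ : K * n.+1 - k.+1 = (K * n.+1 - k).-1)%N; last lia.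
case e: (K * n.+1 - k)%N => [|m]; first lia.
rewrite heightS (_ : (K * n.+1 - k.+1 = m)%N); last lia.
by rewrite /=; ring.
Qed.

Lemma compat_mirror U S b c :
  compat (mirror (~: U)) (mirror S) c b = compat U S b c.
Proof.
have imp U' S' b' c' : compat U' S' b' c' ->
    compat (mirror (~: U')) (mirror S') c' b'.
  move=> co; apply/compatP => i j ij; apply/negP => /mutualP[].
  set K := j.+1; have jK : (j < K * n.+1)%N by rewrite /K mulnS; lia.
  have iK : (i < K * n.+1)%N by lia.
  rewrite !(on_mirror _ iK) !(on_mirror _ jK).
  rewrite !onC negbK => hi hj hm.
  set i1 := (K * n.+1 - j.+1)%N in hj *; set j1 := (K * n.+1 - i.+1)%N in hi *.
  have /negP[] := elimT (compatP _ _ _ _) co i1 j1 ltac:(lia).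
  apply/mutualP; split=> // m mb.
  have := hm (K * n.+1 - m)%N ltac:(lia).
  rewrite -mirrorC setCK !(@height_mirror _ _ _ _ K); try lia.
  rewrite (_ : (K * n.+1 - (K * n.+1 - m) = m)%N); last lia.
  rewrite (_ : j1.+1 = K * n.+1 - i)%N; last lia.
  rewrite -/i1; lia.
apply/idP/idP => [/imp|]; last exact: imp.
by rewrite mirrorC !mirrorK setCK.
Qed.

Lemma compat_count_mirror U b c p q :
  compat_count (mirror (~: U)) c b q p = compat_count U b c p q.
Proof.
rewrite /compat_count -(card_imset _ (inv_inj mirrorK)).
apply: eq_card => S; rewrite [RHS]inE.
have cD : #|mirror S :\: mirror (~: U)| = #|S :&: U|.
  by rewrite mirrorC setDE setCK -preimsetI card_mirror.
have cI : #|mirror S :&: mirror (~: U)| = #|S :\: U|.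
  by rewrite -preimsetI card_mirror -setDE.
apply/imsetP/idP => [[T]|hS].
  rewrite inE => hT eT; move: hT.
  have -> : T = mirror S by rewrite eT mirrorK.
  by rewrite cD cI compat_mirror => /and3P[-> -> ->].
exists (mirror S); last by rewrite mirrorK.
by rewrite inE cD cI compat_mirror; move: hS => /and3P[-> -> ->].
Qed.

(** Modulo n.+1 the numbers a1 and - a2 agree, so that a1 * i is congruent to
    a2 * (n - i) + a2, where n - i is the position reversed from i. *)
Lemma mirror_christoffel a1 a2 : (a1 + a2 = n.+1)%N ->
  mirror (~: christoffel n a1 a2) = christoffel n a2 a1.
Proof.
move=> a12; apply/setP => i; rewrite !inE /=.
have -> : ((a1 * i) %% n.+1 = ((a2 * (n - i)) %% n.+1 + a2) %% n.+1)%N.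
  rewrite modnDml -(modnMDl a2) -(modnMDl i (_ + a2)%N).
  congr (_ %% _)%N; have := ltn_ord i; rewrite ltnS => i_n.
  have -> : (a2 * n.+1 = a2 * (n - i) + a2 * i + a2)%N.
    by rewrite -mulnDr subnK // mulnS addnC.
  have -> : (i * n.+1 = i * a1 + i * a2)%N by rewrite -mulnDr a12.
  by lia.
rewrite subSS; set h := ((a2 * (n - i)) %% n.+1)%N.
have hn : (h < n.+1)%N by rewrite ltn_mod.
have [ha|ha] := ltnP h a1; first by rewrite modn_small; lia.
rewrite (_ : (h + a2)%N = (h - a1) + n.+1)%N; last lia.
by rewrite modnDr modn_small; lia.
Qed.
End Mirror.

(** * Inverting a binomial convolution *)

Section Inversion.
Implicit Types (f g : nat -> int) (B q : nat).

(** The coefficients of the product of f, as a power series, with (1 + x)^B and,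
    in [deconvbin], with (1 + x)^(- B); for B = 0 the predecessor of k is
    harmless since 'C(k.-1, k) = 0 for k > 0. *)
Definition convbin B f q : int := \sum_(j < q.+1) f j * ('C(B, q - j))%:Z.
Definition deconvbin B f q : int :=
  \sum_(k < q.+1) (-1) ^+ k * f (q - k)%N * ('C((B + k).-1, k))%:Z.

Lemma convbin0 f q : convbin 0 f q = f q.
Proof.
rewrite /convbin big_ord_recr /= subnn mulr1 big1 ?add0r // => j _.
by rewrite bin0n subn_eq0 leqNgt ltn_ord mulr0.
Qed.

Lemma deconvbin0 f q : deconvbin 0 f q = f q.
Proof.
rewrite /deconvbin big_ord_recl /= subn0 expr0 mul1r mulr1.
rewrite big1 ?addr0 // => j _.
by rewrite bin_small ?mulr0 //= add0n.
Qed.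

Lemma convbinS B f q : convbin B.+1 f q =
  convbin B f q + (if q is q'.+1 then convbin B f q' else 0).
Proof.
rewrite /convbin; case: q => [|q]; first by rewrite !big_ord1 addr0 !bin0.
rewrite big_ord_recr [in RHS]big_ord_recr /= subnn !bin0 addrAC -big_split /=.
congr (_ + _); apply: eq_bigr => j _.
have jq : (j <= q)%N by rewrite -ltnS.
by rewrite subSn // binS PoszD mulrDr.
Qed.

Lemma deconvbinS B f g q :
  (forall q, g q = f q + (if q is q'.+1 then f q' else 0)) ->
  deconvbin B.+1 g q = deconvbin B f q.
Proof.
move=> gE; rewrite /deconvbin.
under eq_bigr => k _ do rewrite gE mulrDr mulrDl.
rewrite big_split /= [X in _ + X]big_ord_recr /= subnn mulr0 mul0r addr0.
rewrite big_ord_recl [in RHS]big_ord_recl /= !bin0 -addrA; congr (_ + _).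
rewrite -big_split /=; apply: eq_bigr => k _.
rewrite /bump /= add1n (_ : (q - k)%N = (q - k.+1).+1); last first.
  by have := ltn_ord k; lia.
rewrite !addnS /= binS PoszD exprS; ring.
Qed.

(** Both convolutions change by one factor 1 + x at a time. *)
Lemma convbinK B f q : deconvbin B (convbin B f) q = f q.
Proof.
elim: B q => [|B IH] q; first by rewrite deconvbin0 convbin0.
by rewrite (deconvbinS _ _ (convbinS B f)).
Qed.

(** For a <= d the convolution is trivial and so is the sum: its binomials have
    an upper entry below k, possibly negative. *)
Lemma recurrence_defect (a d : nat) f g q :
  (forall q, f q = convbin (a - d) g q) ->
  f q - \sum_(1 <= k < q.+1) (-1) ^+ (k - 1)%N * f (q - k)%N
      * binz (a%:Z - d%:Z + k%:Z - 1) k = g q.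
Proof.
move=> fE; rewrite -(convbinK (a - d) g q) /deconvbin big_ord_recl /= subn0.
rewrite expr0 mul1r bin0 mulr1 -fE; congr (_ + _).
rewrite big_add1 /= big_mkord -sumrN; apply: eq_bigr => k _.
rewrite /bump /= add1n fE subn1 /= exprS mulN1r !mulNr; congr (- (_ * _)).
have [le|gt] := leqP a d; last first.
  by rewrite (_ : _ - 1 = ((a - d + k.+1).-1)%:Z) //; lia.
rewrite (_ : (a - d = 0)%N); last lia.
rewrite add0n /= (bin_small (ltnSn k)).
case e: (_ - 1) => [z|z] //=; rewrite bin_small //; lia.
Qed.
End Inversion.

(** * The two rules *)

Section Rules.
Variables (b c a1 a2 : nat).
Implicit Types (f g : nat -> nat -> int) (p q : nat).

Lemma eq_sum1 f g p q : (forall i, (i < p)%N -> f i q = g i q) ->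
  sum1 c a2 f p q = sum1 c a2 g p q.
Proof.
by move=> fg; apply: eq_big_nat => k kb; rewrite fg //; lia.
Qed.

Lemma eq_sum2 f g p q : (forall j, (j < q)%N -> f p j = g p j) ->
  sum2 b a1 f p q = sum2 b a1 g p q.
Proof.
by move=> fg; apply: eq_big_nat => k kb; rewrite fg //; lia.
Qed.

(** Either sum at (p, q) involves only values with a smaller p + q. *)
Lemma rule_uniq f g : f 0%N 0%N = g 0%N 0%N ->
  (forall p q, (p, q) <> (0%N, 0%N) ->
     sum1 c a2 f p q = sum1 c a2 g p q -> sum2 b a1 f p q = sum2 b a1 g p q ->
     f p q = g p q) ->
  forall p q, f p q = g p q.
Proof.
move=> fg0 step p q; move: {2}(p + q)%N (leqnn (p + q)) => s.
elim: s p q => [|s IH] p q pq.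
  by have [-> ->] : p = 0%N /\ q = 0%N by lia.
have [/eqP [-> ->] //|/eqP pq0] := boolP ((p, q) == (0, 0)%N).
apply: step => //; [apply: eq_sum1 => i ?|apply: eq_sum2 => j ?];
  apply: IH; lia.
Qed.

Lemma max_rule_uniq f g : f 0%N 0%N = g 0%N 0%N ->
  max_rule b c a1 a2 f -> max_rule b c a1 a2 g -> forall p q, f p q = g p q.
Proof.
move=> fg0 hf hg; apply: rule_uniq => // p q pq0 e1 e2.
by rewrite hf // hg // e1 e2.
Qed.

Lemma slope_rule_uniq f g : f 0%N 0%N = g 0%N 0%N ->
  slope_rule b c a1 a2 f -> slope_rule b c a1 a2 g -> forall p q, f p q = g p q.
Proof.
move=> fg0 hf hg; apply: rule_uniq => // p q pq0 e1 e2.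
have [f1 f2] := hf p q pq0; have [g1 g2] := hg p q pq0.
have [le|/ltnW le] := leqP (c * a1 * q) (b * a2 * p).
  by rewrite f1 // g1.
by rewrite f2 // g2.
Qed.

(** For p = 0 nothing is shadowed, so the only reduced set is empty. *)
Lemma reduced_count_christoffel n m1 m2 d e p j : (m1 + m2 = n.+1)%N ->
  (0 < d)%N -> (0 < m2)%N -> (p, j) <> (0%N, 0%N) ->
  (d * m2 * p <= e * m1 * j)%N ->
  reduced_count (christoffel n m1 m2) d e p j = 0%N.
Proof.
move=> m12 d0 m20 pj0 le; apply: eq_card0 => T; rewrite inE.
apply/negP => /and4P[/eqP cD co rT /eqP cI].
have [p0|p0] := posnP p.
  case: pj0; congr (_, _) => //.
  have D0 : T :\: christoffel n m1 m2 = set0 by apply: cards0_eq; rewrite cD.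
  have sh0 : shadow (christoffel n m1 m2) T d = set0.
    apply/setP => i; rewrite !inE; apply/negP => /andP[_ /existsP[L]].
    rewrite !heightE D0; have occ0 k : occ (set0 : {set 'I_n.+1}) k = 0%N.
      by rewrite /occ big1 // => x _; rewrite /on inE.
    rewrite !occ0 !muln0 !sub0r ltrN2 ltz_nat ltnNge /occ big_split_ord /=.
    by rewrite leq_addr.
  by rewrite -cI; apply/eqP; rewrite cards_eq0 -subset0 -sh0.
have := reduced_slope m12 d0 m20 co rT; rewrite cD cI; lia.
Qed.

Lemma compat_count00 n (U : {set 'I_n.+1}) d e : compat_count U d e 0 0 = 1%N.
Proof.
rewrite -(cards1 (set0 : {set 'I_n.+1})); apply: eq_card => S; rewrite !inE.
apply/and3P/eqP => [[D0 _ I0]|->].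
  rewrite -(setID S U); move: D0 I0; rewrite !cards_eq0 => /eqP -> /eqP ->.
  by rewrite setU0.
rewrite set0D set0I cards0; split=> //.
apply/compatP => i j _; apply/negP => /mutualP[].
by rewrite /on !inE andbF.
Qed.

Lemma compat_count_sum2 n m1 m2 d e f p q : (m1 + m2 = n.+1)%N ->
  (forall p q, f p q = (compat_count (christoffel n m1 m2) d e p q)%:Z) ->
  f p q - sum2 d m1 f p q = (reduced_count (christoffel n m1 m2) d e p q)%:Z.
Proof.
move=> m12 fE; rewrite -(@recurrence_defect m1 (d * p) (f p)
  (fun j => (reduced_count (christoffel n m1 m2) d e p j)%:Z)) //.
move=> j; rewrite fE compat_countE (card_christoffel m12) /convbin.
rewrite (big_morph Posz PoszD (erefl _)).
by apply: eq_bigr => i _; rewrite PoszM.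
Qed.

End Rules.

Theorem proposition1p6 (b c a1 a2 : nat)
    (hb : (0 < b)%N) (hc : (0 < c)%N) (ha1 : (0 < a1)%N) (ha2 : (0 < a2)%N)
    (coef : nat -> nat -> int) (h00 : coef 0%N 0%N = 1%R) :
  max_rule b c a1 a2 coef <-> slope_rule b c a1 a2 coef.
Proof.
pose n := (a1 + a2).-1.
have a12 : (a1 + a2 = n.+1)%N by rewrite /n; lia.
have a21 : (a2 + a1 = n.+1)%N by rewrite addnC.
pose f p q : int := (compat_count (christoffel n a1 a2) b c p q)%:Z.
pose P p q := reduced_count (christoffel n a2 a1) c b q p.
pose Q p q := reduced_count (christoffel n a1 a2) b c p q.
have f1 p q : f p q - sum1 c a2 f p q = (P p q)%:Z.
  apply: (@compat_count_sum2 n a2 a1 c b (fun q p => f p q)) => // {}q {}p.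
  by rewrite /f -(mirror_christoffel a12) compat_count_mirror.
have f2 p q : f p q - sum2 b a1 f p q = (Q p q)%:Z.
  exact: compat_count_sum2.
have P0 p q : (p, q) <> (0%N, 0%N) ->
    (c * a1 * q <= b * a2 * p)%N -> P p q = 0%N.
  move=> pq0; apply: reduced_count_christoffel => //.
  by case=> *; apply: pq0; congr (_, _).
have Q0 p q : (p, q) <> (0%N, 0%N) ->
    (b * a2 * p <= c * a1 * q)%N -> Q p q = 0%N.
  by move=> pq0; apply: reduced_count_christoffel.
have fslope : slope_rule b c a1 a2 f.
  move=> p q pq0; split=> le.
    by have := f1 p q; rewrite P0 // => /eqP; rewrite subr_eq0 => /eqP.
  by have := f2 p q; rewrite Q0 // => /eqP; rewrite subr_eq0 => /eqP.
have fmax : max_rule b c a1 a2 f.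
  move=> p q pq0; have [e1 e2] := fslope p q pq0.
  have := f1 p q; have := f2 p q.
  have [/e1|/ltnW /e2] := leqP (c * a1 * q) (b * a2 * p); lia.
have cf0 : coef 0%N 0%N = f 0%N 0%N by rewrite h00 /f compat_count00.
split=> h p q pq0.
  have e := max_rule_uniq cf0 h fmax.
  have [e1 e2] := fslope p q pq0; split=> le.
    by rewrite e e1 //; apply: eq_sum1 => *; rewrite e.
  by rewrite e e2 //; apply: eq_sum2 => *; rewrite e.
have e := slope_rule_uniq cf0 h fslope.
rewrite e fmax //; congr (Num.max _ _).
  by apply: eq_sum1 => *; rewrite e.
by apply: eq_sum2 => *; rewrite e.
Qed.
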